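(* Let $N$ and $d$ be positive integers. If there exists an amicable pair of $2N\times 2N$ Hadamard matrices and there exists a $d\times 2d$ equiangular tight frame, then there exists a $2dN\times 4dN$ equiangular tight frame.
   Context: A $d\times n$ equiangular tight frame (ETF) is a collection of $n$ unit vectors $x_1,\dots,x_n$ in $\mathbb{C}^d$ attaining the Welch bound, i.e. $\max_{i\neq j}|\langle x_i,x_j\rangle|^2=\frac{n-d}{d(n-1)}$. A Hadamard matrix of order $n$ is an $n\times n$ matrix $H$ with entries $\pm1$ and $HH^{\mathrm T}=nI_n$. It is symmetric if $H=H^{\mathrm T}$ and skew Hadamard if $H=C+I_n$ with $C^{\mathrm T}=-C$. A pair $(A,B)$ of Hadamard matrices of the same order is amicable if $A$ is symmetric, $B$ is skew Hadamard, and $AB^{\mathrm T}=BA^{\mathrm T}$. *)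

(* Defs.v *)
From mathcomp Require Import all_boot all_order all_algebra.
From mathcomp Require Import reals complex.

Set Implicit Arguments.
Unset Strict Implicit.
Unset Printing Implicit Defensive.

Import Order.TTheory GRing.Theory Num.Theory.
Local Open Scope ring_scope.
Local Open Scope complex_scope.

(* max_(i != j) |<x_i, x_j>|^2, a maximum of nonnegative reals indexed by the
   ordered pairs of distinct indices. The index set is nonempty as soon as
   1 < n, and then 0 is neutral; the value is 0 by convention if n <= 1. *)
Definition coherence2 (R : realType) (d n : nat)
    (x : 'I_n -> 'rV[R[i]]_d) : R :=
  \big[Num.max/0]_(p : 'I_n * 'I_n | p.1 != p.2)
    Normc.normc (dotmx (x p.1) (x p.2)) ^+ 2.

(* Vectors of C^d are row vectors, so that dotmx is their standard Hermitian
   inner product. *)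
Definition is_ETF (R : realType) (d n : nat)
    (x : 'I_n -> 'rV[R[i]]_d) : Prop :=
  (forall i, dotmx (x i) (x i) = 1) /\
  coherence2 x = (n%:R - d%:R) / (d%:R * (n%:R - 1)).

Definition hadamard (n : nat) (H : 'M[int]_n) : Prop :=
  (forall i j, H i j = 1 \/ H i j = -1) /\ H *m H^T = n%:R%:M.

Definition symmetric_hadamard (n : nat) (H : 'M[int]_n) : Prop :=
  hadamard H /\ H = H^T.

Definition skew_hadamard (n : nat) (H : 'M[int]_n) : Prop :=
  hadamard H /\ exists C : 'M[int]_n, H = C + 1%:M /\ C^T = - C.

Definition amicable_hadamard (n : nat) (A B : 'M[int]_n) : Prop :=
  [/\ symmetric_hadamard A, skew_hadamard B & A *m B^T = B *m A^T].

(* Main.v *)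
(* A d x 2d ETF with Gram matrix G attains equality in the Welch bound, so
   G^2 = 2G and G = 1 + S / sqrt(2d - 1), where S is a Hermitian conference
   matrix: zero diagonal, unimodular off-diagonal entries, S^2 = (2d - 1) 1.
   Conversely, for such an S of order n = 2m, the matrix (1 + S/sqrt(n - 1))/2
   is an orthogonal projection of rank m, hence V V^* for some n x m matrix V,
   and the rows of sqrt(2) V form an m x n ETF.
   If (A, 1 + K) is amicable of order 2N, then A K = - K A, A^2 = 2N and
   (iK)^2 = 2N - 1, so the two terms of S (x) A + 1 (x) iK anticommute, and
   its square is (2d - 1) 2N + (2N - 1) = 4dN - 1. *)
Require Import Defs.
From mathcomp Require Import all_boot all_order all_algebra.
From mathcomp Require Import reals complex mxtens.
From mathcomp Require Import zify ring.

Set Implicit Arguments.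
Unset Strict Implicit.
Unset Printing Implicit Defensive.

Import Order.TTheory GRing.Theory Num.Theory.
Local Open Scope ring_scope.
Local Open Scope sesquilinear_scope.

Section HermitianMatrices.
Variable C : numClosedFieldType.

(** * Adjoints, the Frobenius norm and factorization of projections *)

Lemma adjmx_mul m n p (A : 'M[C]_(m, n)) (B : 'M[C]_(n, p)) :
  (A *m B)^t* = B^t* *m A^t*.
Proof. by rewrite trmx_mul map_mxM. Qed.

Lemma mxtrace_mul_adj m n (A : 'M[C]_(m, n)) :
  \tr (A *m A^t*) = \sum_i \sum_j `|A i j| ^+ 2.
Proof.
apply: eq_bigr => i _; rewrite mxE; apply: eq_bigr => j _.
by rewrite !mxE normCK.
Qed.

Lemma mxtrace_mul_adj_ge0 m n (A : 'M[C]_(m, n)) : 0 <= \tr (A *m A^t*).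
Proof.
rewrite mxtrace_mul_adj; apply: sumr_ge0 => i _; apply: sumr_ge0 => j _.
exact: exprn_ge0.
Qed.

Lemma mxtrace_mul_adj_eq0 m n (A : 'M[C]_(m, n)) :
  \tr (A *m A^t*) = 0 -> A = 0.
Proof.
rewrite mxtrace_mul_adj => A0; apply/matrixP => i j; rewrite mxE.
have A2_ge0 k l : 0 <= `|A k l| ^+ 2 by exact: exprn_ge0.
have Ai0 := psumr_eq0P (fun k _ => sumr_ge0 _ (fun l _ => A2_ge0 k l)) A0.
have /(_ j isT)/eqP := psumr_eq0P (fun l _ => A2_ge0 i l) (Ai0 i isT).
by rewrite sqrf_eq0 normr_eq0 => /eqP.
Qed.

(** Gram-Schmidt on a basis of the row space of [P] gives [U] with orthonormal rows. Being Hermitian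
    and idempotent, [P] is the orthogonal projection onto that space, so it equals [U^t* *m U], and
    its trace counts the rows of [U]. *)
Lemma hermitian_idempotent_factor n r (P : 'M[C]_n) :
    P^t* = P -> P *m P = P -> \tr P = r%:R ->
  exists V : 'M[C]_(n, r), V *m V^t* = P.
Proof.
move=> hermP idemP trP.
have [k [U [Uuni eqUP]]] : exists k (U : 'M[C]_(k, n)),
    U *m U^t* = 1%:M /\ (U :=: P)%MS.
  exists (\rank P), (schmidt (row_base P)); split.
    by apply/unitarymxP/schmidt_unitarymx; apply: rank_leq_row.
  by apply: eqmx_trans (eqmx_schmidt_free _) (eq_row_base _); exact: row_base_free.
have UP : U *m P = U.
  have /submxP[X ->] : (U <= P)%MS by rewrite eqUP.
  by rewrite -mulmxA idemP.
have PUU : P *m U^t* *m U = P.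
  have /submxP[Z ->] : (P <= U)%MS by rewrite eqUP.
  by rewrite -(mulmxA Z) Uuni mulmx1.
(* The adjoint of [UP] reads P U^* = U^*, which removes the factor [P] from [PUU]. *)
have PE : U^t* *m U = P by rewrite -PUU -{1}hermP -adjmx_mul UP.
have kr : k = r.
  by apply/eqP; rewrite -(eqr_nat C) -trP -PE mxtrace_mulC Uuni mxtrace1.
by case: _ / kr; exists (U^t* ); rewrite trmxCK.
Qed.

(** * Equality in the Welch bound *)

Lemma sum_neq_const n (c : C) :
  \sum_(i < n) \sum_(j < n | i != j) c = c * (n%:R * (n%:R - 1)).
Proof.
rewrite (eq_bigr (fun=> c * (n%:R - 1))) => [|i _].
  by rewrite sumr_const card_ord -mulr_natr; ring.
have := sumr_const 'I_n c; rewrite card_ord (bigD1 i) //=.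
rewrite (eq_bigl (fun j => i != j)) => [|j]; last by rewrite eq_sym.
by move=> /(canRL (addKr _)) ->; rewrite -mulr_natr; ring.
Qed.

(* Equality in the Welch bound: tr ((X^* X - n/d)^2) plus the total slack
   sum_(i != j) (c - |G i j|^2) vanishes, and both terms are nonnegative. *)
Lemma Welch_equality d n (X : 'M[C]_(n, d)) (G := X *m X^t*)
    (c : C := (n%:R - d%:R) / (d%:R * (n%:R - 1))) :
    (0 < d)%N -> (1 < n)%N -> (forall i, G i i = 1) ->
    (forall i j, i != j -> `|G i j| ^+ 2 <= c) ->
  G *m G = (n%:R / d%:R) *: G /\ (forall i j, i != j -> `|G i j| ^+ 2 = c).
Proof.
move=> d_gt0 n_gt1 G1 Gc.
have d_neq0 : d%:R != 0 :> C by rewrite pnatr_eq0 -lt0n.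
have n1_neq0 : n%:R - 1 != 0 :> C by rewrite subr_eq0 (eqr_nat C n 1) gtn_eqF.
have hermG : G^t* = G by rewrite adjmx_mul trmxCK.
(* [F] is the d x d frame operator. Its trace is n, so [a] is its mean eigenvalue, and [D = 0] says
   that the frame is tight. *)
pose a : C := n%:R / d%:R; pose F := X^t* *m X; pose D := F - a%:M.
have hermF : F^t* = F by rewrite adjmx_mul trmxCK.
have realA : a^* = a by rewrite fmorph_div /= !rmorph_nat.
have hermD : D^t* = D.
  by rewrite raddfB /= map_mxB hermF tr_scalar_mx map_scalar_mx /= realA.
have trG : \tr G = n%:R.
  by rewrite /mxtrace (eq_bigr (fun=> 1)) ?sumr_const ?card_ord // => i _; exact: G1.
have trF : \tr F = n%:R by rewrite mxtrace_mulC.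
have trFF : \tr (F *m F) = \tr (G *m G^t*).
  by rewrite hermG -mulmxA mxtrace_mulC -!mulmxA.
have trGG : \tr (G *m G^t*) = n%:R + \sum_i \sum_(j | i != j) `|G i j| ^+ 2.
  rewrite mxtrace_mul_adj (eq_bigr (fun i => 1 + \sum_(j | i != j) `|G i j| ^+ 2)).
    by rewrite big_split /= sumr_const card_ord.
  move=> i _; rewrite (bigD1 i) //= G1 normr1 expr1n; congr (_ + _).
  by apply: eq_bigl => j; rewrite eq_sym.
pose slack := \sum_i \sum_(j | i != j) (c - `|G i j| ^+ 2).
have slack_ge0 i j : i != j -> 0 <= c - `|G i j| ^+ 2.
  by move=> ij; rewrite subr_ge0 Gc.
have rowslack_ge0 i : 0 <= \sum_(j | i != j) (c - `|G i j| ^+ 2).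
  by apply: sumr_ge0 => j; exact: slack_ge0.
have total0 : \tr (D *m D^t*) + slack = 0.
  have -> : slack = c * (n%:R * (n%:R - 1))
                    - \sum_i \sum_(j | i != j) `|G i j| ^+ 2.
    by rewrite -sum_neq_const -sumrB; apply: eq_bigr => i _; rewrite sumrB.
  have -> : \tr (D *m D^t*) = \tr (F *m F) - (a *+ 2) * n%:R + a ^+ 2 * d%:R.
    rewrite hermD mulmxBr !mulmxBl !(mul_scalar_mx, mul_mx_scalar).
    rewrite scale_scalar_mx !raddfB /= !mxtraceZ trF mxtrace_scalar.
    by rewrite -[(a * a) *+ d]mulr_natr; ring.
  (* The sums of |G i j|^2 cancel; what is left is n - n^2/d + c n (n - 1), which is 0 by the value
     of [c]. *)
  rewrite trFF trGG /a /c; field.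
  by rewrite d_neq0 n1_neq0.
have [D0 slack0] : \tr (D *m D^t*) = 0 /\ slack = 0.
  have trD_ge0 := mxtrace_mul_adj_ge0 D.
  have := total0; move/eqP; rewrite paddr_eq0 //; last exact: sumr_ge0.
  by case/andP => /eqP ? /eqP.
split=> [|i j ij].
  have FE : F = a%:M by apply/eqP; rewrite -subr_eq0; apply/eqP/mxtrace_mul_adj_eq0.
  by rewrite /G mulmxA -(mulmxA X) -/F FE mul_mx_scalar -scalemxAl.
have /(_ i isT) row0 := psumr_eq0P (fun k _ => rowslack_ge0 k) slack0.
have /(_ j ij)/eqP := psumr_eq0P (slack_ge0 i) row0.
by rewrite subr_eq0 => /eqP.
Qed.

(** * Hermitian conference matrices and Gram matrices of frames *)

Definition hermitian_conference n (S : 'M[C]_n) : Prop :=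
  [/\ S^t* = S, forall i, S i i = 0, forall i j, i != j -> `|S i j| = 1
    & S *m S = (n%:R - 1)%:M].

Lemma hermitian_conference_of_gram m n (G : 'M[C]_n)
    (c : C := (n%:R - 1)^-1) :
    n = (2 * m)%N -> (0 < m)%N -> G^t* = G ->
    (forall i, G i i = 1) -> (forall i j, i != j -> `|G i j| ^+ 2 = c) ->
    G *m G = 2 *: G ->
  hermitian_conference ((sqrtC c)^-1 *: (G - 1%:M)).
Proof.
move=> nm m_gt0 hermG G1 Gc GG.
have n1_gt0 : 0 < n%:R - 1 :> C by rewrite subr_gt0 (ltr_nat C 1); lia.
have c_gt0 : 0 < c by rewrite invr_gt0.
pose s : C := (sqrtC c)^-1.
have s_gt0 : 0 < s by rewrite invr_gt0 sqrtC_gt0.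
have s2 : s * s = n%:R - 1 by rewrite -expr2 exprVn sqrtCK invrK.
have realS : s^* = s by apply/CrealP/gtr0_real.
rewrite -/s; split=> [|i|i j ij|].
- by rewrite linearZ /= map_mxZ raddfB /= map_mxB hermG trmx1 map_mx1 realS.
- by rewrite !mxE G1 eqxx subrr mulr0.
- rewrite !mxE (negPf ij) subr0; apply: (pexpIrn (n := 2)) => //; rewrite ?nnegrE //.
  by rewrite normrM exprMn Gc // gtr0_norm // expr2 s2 expr1n divff // gt_eqF.
- rewrite -scalemxAl -scalemxAr scalerA s2 mulmxBl !mulmxBr GG !(mul1mx, mulmx1).
  by rewrite scaler_nat mulr2n addrK subKr scalemx1.
Qed.

Lemma hermitian_conference_gram m n (S : 'M[C]_n) :
    n = (2 * m)%N -> (0 < m)%N -> hermitian_conference S ->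
  exists V : 'M[C]_(n, m),
    (forall i, (V *m V^t*) i i = 1)
    /\ (forall i j, i != j -> `|(V *m V^t*) i j| ^+ 2 = (n%:R - 1)^-1).
Proof.
move=> nm m_gt0 [hermS S0 S1 SS].
have n1_gt0 : 0 < n%:R - 1 :> C by rewrite subr_gt0 (ltr_nat C 1); lia.
pose s : C := (sqrtC (n%:R - 1))^-1.
have s_gt0 : 0 < s by rewrite invr_gt0 sqrtC_gt0.
have s2 : s ^+ 2 = (n%:R - 1)^-1 by rewrite exprVn sqrtCK.
have realS : s^* = s by apply/CrealP/gtr0_real.
pose G := 1%:M + s *: S.
have hermG : G^t* = G.
  by rewrite raddfD /= map_mxD linearZ /= map_mxZ /= trmx1 map_mx1 hermS realS.
have GG : G *m G = 2 *: G.
  rewrite mulmxDl !mulmxDr !(mul1mx, mulmx1) -scalemxAl -scalemxAr scalerA SS.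
  rewrite -expr2 s2 scale_scalar_mx mulVf ?gt_eqF // (addrC (s *: S)).
  by rewrite -/G scaler_nat mulr2n.
have Gdiag i : G i i = 1 by rewrite !mxE S0 eqxx mulr0 addr0.
have half2 : (2^-1 : C)^* = 2^-1 by rewrite fmorphV rmorph_nat.
have [|||W WW] := @hermitian_idempotent_factor n m (2^-1 *: G).
- by rewrite linearZ /= map_mxZ /= hermG half2.
- rewrite -scalemxAl -scalemxAr GG !scalerA; congr (_ *: _).
  by field.
(* The unit diagonal of [G] gives the projection G/2 the trace n/2 = m, hence the rank. *)
- rewrite mxtraceZ /mxtrace (eq_bigr (fun=> 1)) => [|i _]; last exact: Gdiag.
  by rewrite sumr_const card_ord nm natrM mulKf ?pnatr_eq0.
have sqrt2 : (sqrtC 2 : C)^* = sqrtC 2.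
  by apply/CrealP/ger0_real; rewrite sqrtC_ge0 ler0n.
exists (sqrtC 2 *: W).
have -> : sqrtC 2 *: W *m (sqrtC 2 *: W)^t* = G.
  rewrite linearZ /= map_mxZ /= sqrt2 -scalemxAl -scalemxAr scalerA.
  by rewrite -expr2 sqrtCK WW scalerA mulfV ?pnatr_eq0 // scale1r.
split=> // i j ij.
by rewrite !mxE (negPf ij) add0r normrM S1 // mulr1 gtr0_norm.
Qed.

(** * The tensor product construction *)

Lemma tens_scalar_scalar m k (a b : C) :
  (a%:M : 'M_m) *t (b%:M : 'M_k) = (a * b)%:M.
Proof.
apply/matrixP => i j.
case: (mxtens_indexP i) => {}i p; case: (mxtens_indexP j) => {}j q.
rewrite tensmxE !mxE (can_eq (@mxtens_indexK m k)) xpair_eqE.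
by rewrite mulrnAl mulrnAr -mulrnA mulnC mulnb.
Qed.

Lemma hermitian_conference_tens m k (S : 'M[C]_m) (A K : 'M[C]_k) :
    hermitian_conference S ->
    A^t* = A -> (forall i j, `|A i j| = 1) -> A *m A = k%:R%:M ->
    hermitian_conference K -> A *m K = - (K *m A) ->
  hermitian_conference (S *t A + 1%:M *t K).
Proof.
move=> [hermS S0 S1 SS] hermA A1 AA [hermK K0 K1 KK] AK.
split=> [|i|i j|].
- rewrite raddfD /= map_mxD !trmx_tens !map_mxT /=.
  by rewrite hermS hermA hermK trmx1 map_mx1.
- by case: (mxtens_indexP i) => {}i p; rewrite mxE !tensmxE S0 K0 mul0r mulr0 addr0.
- case: (mxtens_indexP i) => {}i p; case: (mxtens_indexP j) => {}j q.
  (* The two terms have disjoint supports: in diagonal blocks (i = j) only [K] contributes, in the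
     others only [S *t A]. *)
  rewrite mxE !tensmxE mxE => neq; case: (eqVneq i j) neq => [->|ij] neq.
    by rewrite S0 mul0r add0r mul1r K1 //; apply: contraNneq neq => ->.
  by rewrite mul0r addr0 normrM S1 // A1 mulr1.
- have tensD (X : 'M[C]_m) (Y Z : 'M[C]_k) : X *t Y + X *t Z = X *t (Y + Z).
    by apply/matrixP => i j; rewrite !mxE mulrDr.
  rewrite mulmxDl !mulmxDr !tensmx_mul !(mul1mx, mulmx1) SS AA KK AK.
  (* The cross terms add up to S (x) (AK + KA) = 0. *)
  rewrite -addrA (addrA (S *t _)) tensD addNr tensmx0 add0r.
  rewrite !tens_scalar_scalar -raddfD /= natrM; congr (_%:M).
  by ring.
Qed.

(** * From integer Hadamard matrices to complex conference matrices *)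

Lemma adjmx_intr m n (A : 'M[int]_(m, n)) :
  (map_mx intr A : 'M[C]_(m, n))^t* = map_mx intr A^T.
Proof. by apply/matrixP => i j; rewrite !mxE /= rmorph_int. Qed.

Lemma hadamard_norm n (H : 'M[int]_n) i j :
  hadamard H -> `|(H i j)%:~R| = 1 :> C.
Proof. by case=> /(_ i j)[] -> _; rewrite ?rmorphN ?normrN normr1. Qed.

(** The factor i makes a real skew-symmetric matrix Hermitian and negates its square; (1 + K)(1 - K)
    = n gives K^2 = -(n - 1). *)
Lemma hermitian_conference_skew n (K : 'M[int]_n) :
    K^T = - K -> hadamard (K + 1%:M) ->
  hermitian_conference ('i *: map_mx intr K : 'M[C]_n).
Proof.
move=> skewK hadB.
have K0 i : K i i = 0.
  have /matrixP/(_ i i)/eqP := skewK; rewrite !mxE -subr_eq0 opprK.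
  by rewrite -mulr2n mulrn_eq0 => /eqP.
have KK : K *m K = - (n%:R - 1)%:M.
  have [_] := hadB; rewrite linearD /= trmx1 skewK mulmxDl !mulmxDr.
  rewrite !(mulmxN, mul1mx, mulmx1) => /(canRL (addrK _)).
  rewrite opprD opprK [RHS]addrCA [LHS]addrC => /addrI KK.
  by apply: oppr_inj; rewrite opprK KK raddfB.
split=> [|i|i j ij|].
- rewrite linearZ /= map_mxZ /= adjmx_intr skewK conjCi.
  by rewrite map_mxN scalerN scaleNr opprK.
- by rewrite !mxE K0 mulr0.
- have := hadamard_norm i j hadB.
  by rewrite !mxE (negPf ij) addr0 normrM normCi mul1r.
- rewrite -scalemxAl -scalemxAr scalerA -map_mxM KK -expr2 sqrCi.
  rewrite map_mxN scaleN1r opprK map_scalar_mx /=.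
  by rewrite rmorphB rmorph1 /= rmorph_nat.
Qed.

Lemma hermitian_conference_amicable m k (S : 'M[C]_m) (A B : 'M[int]_k) :
    hermitian_conference S -> amicable_hadamard A B ->
  exists T : 'M[C]_(m * k), hermitian_conference T.
Proof.
move=> confS [[hadA symA] [hadB [K [BK skewK]]] AB].
pose a : 'M[C]_k := map_mx intr A.
exists (S *t a + 1%:M *t ('i *: map_mx intr K)).
apply: hermitian_conference_tens => //.
- by rewrite adjmx_intr -symA.
- by move=> i j; rewrite mxE hadamard_norm.
- have [_] := hadA; rewrite -symA -map_mxM => ->.
  by rewrite map_scalar_mx /= rmorph_nat.
- by apply: hermitian_conference_skew => //; rewrite -BK.
- have AK : A *m K = - (K *m A).
    (* Amicability reads A(1 - K) = (1 + K)A; cancelling [A] leaves -AK = KA. *)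
    move: AB; rewrite BK linearD /= trmx1 skewK -symA mulmxDl mulmxDr.
    rewrite mulmxN mulmx1 mul1mx => /addIr AK.
    by rewrite -AK opprK.
  by rewrite -scalemxAl -scalemxAr -!map_mxM AK map_mxN scalerN.
Qed.

End HermitianMatrices.

Local Open Scope complex_scope.

(** * Between frames in C^d and conference matrices *)

Section Coherence.
Variable R : realType.

(** Links the norm of the numeric field [R[i]], whose values lie in [R[i]], to the real-valued
    modulus used in [coherence2]. *)
Lemma normCE (z : R[i]) : `|z| = (Normc.normc z)%:C.
Proof. by []. Qed.

Lemma dotmx_gram d n (V : 'M[R[i]]_(n, d)) i j :
  dotmx (row i V) (row j V) = (V *m V^t*) i j.
Proof.
rewrite dotmxE !mxE; apply: eq_bigr => k _.
by rewrite !mxE.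
Qed.

Lemma normc_le_coherence2 d n (x : 'I_n -> 'rV[R[i]]_d) i j :
  i != j -> Normc.normc (dotmx (x i) (x j)) ^+ 2 <= coherence2 x.
Proof.
move=> ij.
exact: (le_bigmax_cond _ (j := (i, j))
  (fun p => Normc.normc (dotmx (x p.1) (x p.2)) ^+ 2) ij).
Qed.

Lemma coherence2_const d n (x : 'I_n -> 'rV[R[i]]_d) (c : R) :
    (1 < n)%N ->
    (forall i j, i != j -> Normc.normc (dotmx (x i) (x j)) ^+ 2 = c) ->
  coherence2 x = c.
Proof.
move=> n_gt1 xc; pose i0 : 'I_n := Ordinal (ltnW n_gt1); pose i1 := Ordinal n_gt1.
have i01 : i0 != i1 by [].
apply/le_anti; rewrite -[X in _ && (X <= _)](xc _ _ i01) normc_le_coherence2 // andbT.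
(* The default value 0 of the maximum is harmless, since [c] is a square. *)
apply: bigmax_le => [|[i j] ij]; first by rewrite -(xc _ _ i01) sqr_ge0.
by rewrite xc.
Qed.

Lemma conference_of_ETF d (x : 'I_(2 * d) -> 'rV[R[i]]_d) :
  (0 < d)%N -> is_ETF x -> exists S : 'M[R[i]]_(2 * d), hermitian_conference S.
Proof.
move=> d_gt0 [x1 xcoh].
pose X := \matrix_i x i; pose G := X *m X^t*.
have GE i j : G i j = dotmx (x i) (x j) by rewrite -dotmx_gram !rowK.
have G1 i : G i i = 1 by rewrite GE.
pose c : R[i] := ((2 * d)%:R - d%:R) / (d%:R * ((2 * d)%:R - 1)).
have Gc i j : i != j -> `|G i j| ^+ 2 <= c.
  move=> ij; rewrite GE normCE -rmorphXn /=.
  (* The bound is known in [R]; [c] is the embedded real Welch value. *)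
  have -> : c = (((2 * d)%:R - d%:R) / (d%:R * ((2 * d)%:R - 1)) : R)%:C.
    by rewrite /c fmorph_div !(rmorphM, rmorphB, rmorph_nat, rmorph1).
  by rewrite lecR -xcoh normc_le_coherence2.
have [|GG {}Gc] := Welch_equality d_gt0 _ G1 Gc; first by lia.
have d_neq0 : d%:R != 0 :> R[i] by rewrite pnatr_eq0 -lt0n.
have n1_neq0 : (2 * d)%:R - 1 != 0 :> R[i].
  by rewrite subr_eq0 (eqr_nat _ _ 1); lia.
eexists; apply: (@hermitian_conference_of_gram _ d _ G) => //.
- by rewrite adjmx_mul trmxCK.
(* For n = 2d the Welch value (n - d)/(d(n - 1)) is 1/(n - 1), and the tightness constant n/d is
   2. *)
- move=> i j ij; rewrite Gc // natrM; field.
  by rewrite d_neq0 -natrM n1_neq0.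
- by rewrite GG natrM mulfK.
Qed.

Lemma ETF_of_conference m n (S : 'M[R[i]]_n) :
    n = (2 * m)%N -> (0 < m)%N -> hermitian_conference S ->
  exists y : 'I_n -> 'rV[R[i]]_m, is_ETF y.
Proof.
move=> nm m_gt0 /(hermitian_conference_gram nm m_gt0)[V [V1 Vc]].
have m_neq0 : m%:R != 0 :> R by rewrite pnatr_eq0 -lt0n.
have n1_neq0 : n%:R - 1 != 0 :> R.
  by rewrite subr_eq0 (eqr_nat _ _ 1); lia.
exists (fun i => row i V); split=> [i|]; first by rewrite dotmx_gram V1.
apply: coherence2_const => [|i j ij]; first by lia.
(* The real equality is checked after embedding in [R[i]], where [Vc] lives. *)
apply: complexI; rewrite rmorphXn /= -normCE dotmx_gram Vc //.
rewrite -(rmorph_nat (real_complex R)) -(rmorph1 (real_complex R)) -rmorphB.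
rewrite -fmorphV; congr (_%:C).
move: n1_neq0; rewrite nm natrM => n1_neq0.
by field; rewrite n1_neq0 m_neq0.
Qed.

End Coherence.

Theorem theorem2 (R : realType) (N d : nat)
  (hN : (0 < N)%N) (hd : (0 < d)%N)
  (hamicable : exists A B : 'M[int]_(2 * N)%N, amicable_hadamard A B)
  (hETF : exists x : 'I_(2 * d)%N -> 'rV[R[i]]_d, is_ETF x) :
  exists y : 'I_(4 * d * N)%N -> 'rV[R[i]]_(2 * d * N)%N, is_ETF y.
Proof.
have [A [B amicAB]] := hamicable; have [x etfx] := hETF.
have [S confS] := conference_of_ETF hd etfx.
have [T confT] := hermitian_conference_amicable confS amicAB.
(* The order of [T] is 2d times 2N, twice the target dimension 2dN. *)
have <- : (2 * d * (2 * N) = 4 * d * N)%N by lia.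
by apply: ETF_of_conference confT; [lia | rewrite !muln_gt0 hd hN].
Qed.
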